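(* For any integer $n \geq 0$ (with $a$ denoting a nonnegative integer), $$v_2(B_n(3,1)) = \begin{cases} 1 + v_2(a), & \text{if } n=4a \text{ and } v_2(a) \leq 4, \\ 0, & \text{if } n \equiv 1 \pmod{2}, \\ 1 + v_2(a), & \text{if } n=4a+2 \text{ and } v_2(a) \leq 3. \end{cases}$$ (No assertion is made for values of $n$ not covered by these cases.)
   Context: The sequence $\{B_n(3,1)\}_{n\geq 0}$ is defined by $B_n = B_{n-1}+B_{n-2}+B_{n-3}$ for $n \geq 3$, with $(B_0,B_1,B_2)=(0,1,0)$. $v_2$ denotes the 2-adic order (2-adic valuation), with the convention $v_2(0)=+\infty$. *)

(* Defs.v *)
From mathcomp Require Import all_boot all_order all_algebra.
From mathcomp Require Import constructive_ereal.

Set Implicit Arguments.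
Unset Strict Implicit.
Unset Printing Implicit Defensive.

Import GRing.Theory Num.Theory.

(* The sequence B_n(3,1); its terms are nonnegative, so it lives in nat. *)
Fixpoint B31 (n : nat) : nat :=
  match n with
  | 0 => 0
  | 1 => 1
  | 2 => 0
  | ((k.+1 as p).+1 as q).+1 => B31 q + B31 p + B31 k
  end.

(* [logn 2 0] is 0, hence the separate case for the convention v2(0) = +oo. *)
Definition v2 (m : nat) : \bar int :=
  if m == 0 then +oo%E else ((logn 2 m)%:Z)%:E.

(* Main.v *)
(* Modulo 64 the sequence is periodic with period 128, and every valuation in
   the statement is at most 5, so it can be read off the residues over one
   period. *)
Require Import Defs.
From mathcomp Require Import all_boot all_order all_algebra.
From mathcomp Require Import constructive_ereal.

(** A nonzero residue modulo [2 ^ k] has the same 2-adic order as the number itself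
    ([logn_modn_exp]). The bounds on [v2 a] say that [a] is nonzero modulo 32, resp. 16, and [a]
    modulo 32 determines [4 * a] and [4 * a + 2] modulo 128. By periodicity ([trib_state_period])
    each case becomes a finite check on residues modulo 64. *)

(** Iterating on reduced triples keeps evaluation linear in [n] and the unary numbers small, unlike
    the branching recursion of [B31]. *)
Definition trib_step (s : nat * nat * nat) : nat * nat * nat :=
  let: (x, y, z) := s in (y, z, (z + y + x) %% 64).

Definition trib_state (n : nat) : nat * nat * nat := iter n trib_step (0, 1, 0).

Definition B31_mod64 (n : nat) : nat := (trib_state n).1.1.

Lemma trib_stateE n :
  trib_state n = (B31 n %% 64, B31 n.+1 %% 64, B31 n.+2 %% 64).
Proof.
elim: n => // n IHn; rewrite /trib_state iterS -/(trib_state n) IHn /trib_step.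
by rewrite modnDmr -addnA modnDml addnCA modnDml addnCA addnA.
Qed.

Lemma B31_mod64E n : B31 n %% 64 = B31_mod64 n.
Proof. by rewrite /B31_mod64 trib_stateE. Qed.

Lemma trib_state_period n k : trib_state (n + k * 128) = trib_state n.
Proof.
elim: k => [|k IHk]; first by rewrite addn0.
rewrite mulSn addnCA addnC /trib_state iterD.
have ->: iter 128 trib_step (0, 1, 0) = (0, 1, 0) by vm_compute.
exact: IHk.
Qed.

Lemma B31_mod64_modn n : B31_mod64 (n %% 128) = B31_mod64 n.
Proof.
by rewrite {2}(divn_eq n 128) addnC /B31_mod64 trib_state_period.
Qed.

(** Powers of [p] up to [p ^ k] divide [m] and its residue alike, and [p ^ k] itself divides
    neither. *)
Lemma logn_modn_exp p k m : prime p -> m %% p ^ k != 0 ->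
  logn p (m %% p ^ k) = logn p m.
Proof.
move=> p_pr r_neq0; have r_gt0 : 0 < m %% p ^ k by rewrite lt0n.
have m_gt0 : 0 < m by apply: leq_trans (leq_mod m (p ^ k)).
have dvd_mod q : q %| p ^ k -> (q %| m %% p ^ k) = (q %| m).
  by move=> q_dvd; rewrite /dvdn modn_dvdm.
have Nk : ~~ (p ^ k %| m) by rewrite /dvdn.
apply/eqP; rewrite eqn_leq -!pfactor_dvdn // -(dvd_mod (p ^ logn p _)).
  rewrite pfactor_dvdnn dvd_mod ?pfactor_dvdnn // dvdn_exp2l //.
  by apply: ltnW; rewrite ltnNge -pfactor_dvdn.
apply: dvdn_exp2l; apply: ltnW.
by rewrite ltnNge -pfactor_dvdn // dvd_mod.
Qed.

Lemma v2_pos m : 0 < m -> v2 m = ((logn 2 m)%:Z)%:E%E.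
Proof. by rewrite /v2; case: m. Qed.

Lemma v2_modn k m : m %% 2 ^ k != 0 -> v2 m = v2 (m %% 2 ^ k).
Proof.
move=> r_neq0; have r_gt0 : 0 < m %% 2 ^ k by rewrite lt0n.
rewrite !v2_pos ?logn_modn_exp //.
exact: leq_trans (leq_mod m (2 ^ k)).
Qed.

(** Divisibility by [2 ^ j.+1] would force a larger order; the value [+oo] rules out [m = 0]. *)
Lemma v2_leP (j m : nat) :
  (v2 m <= (j%:Z)%:E)%E -> m %% 2 ^ j.+1 != 0.
Proof.
case: m => [|m]; first by [].
rewrite v2_pos // lee_fin lez_nat => le_j.
by apply: contraTN le_j; rewrite -ltnNge -/(dvdn _ _) pfactor_dvdn.
Qed.

Lemma v2_B31 (n r : nat) : B31_mod64 (n %% 128) != 0 ->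
  logn 2 (B31_mod64 (n %% 128)) = r -> v2 (B31 n) = (r%:Z)%:E%E.
Proof.
rewrite B31_mod64_modn -B31_mod64E => B_neq0 <-.
by rewrite (v2_modn 6) // v2_pos // lt0n.
Qed.

Lemma check_4a : all (fun a => (B31_mod64 (4 * a) != 0) &&
  (logn 2 (B31_mod64 (4 * a)) == 1 + logn 2 a)) (iota 1 31).
Proof. by vm_compute. Qed.

(** The range is still a full set of nonzero residues modulo 32, since [n] matters modulo 128; the
    guard, which excludes only 16, encodes [v2 a <= 3]. *)
Lemma check_4a2 : all (fun a => (a %% 16 != 0) ==>
  (B31_mod64 (4 * a + 2) != 0) &&
  (logn 2 (B31_mod64 (4 * a + 2)) == 1 + logn 2 a)) (iota 1 31).
Proof. by vm_compute. Qed.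

Lemma check_odd : all (fun n => odd n ==> odd (B31_mod64 n)) (iota 0 128).
Proof. by vm_compute. Qed.

Lemma modn32_in a : a %% 32 != 0 -> a %% 32 \in iota 1 31.
Proof. by move=> a_neq0; rewrite mem_iota lt0n a_neq0 ltn_mod. Qed.

Lemma v2_modn32 a : a %% 32 != 0 -> v2 a = ((logn 2 (a %% 32))%:Z)%:E%E.
Proof. by move=> a_neq0; rewrite (v2_modn 5) // v2_pos // lt0n. Qed.

Theorem theorem11 (n : nat) :
  [/\ forall a : nat, n = 4 * a ->
        (v2 a <= 4%:E)%E -> v2 (B31 n) = (1%:E + v2 a)%E,
      n = 1 %[mod 2] -> v2 (B31 n) = 0%:E%E
    & forall a : nat, n = 4 * a + 2 ->
        (v2 a <= 3%:E)%E -> v2 (B31 n) = (1%:E + v2 a)%E].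
Proof.
split=> [a -> /(v2_leP 4) a_neq0 | n_odd | a -> /(v2_leP 3) a_neq0].
- rewrite (v2_modn32 _ a_neq0).
  have /andP[B_neq0 /eqP logB] := allP check_4a _ (modn32_in _ a_neq0).
  by apply: v2_B31; rewrite -(muln_modr 4 a 32).
- have odd_n : odd (n %% 128).
    by rewrite odd_mod //; move: n_odd; rewrite !modn2; case: odd.
  have n_in : n %% 128 \in iota 0 128 by rewrite mem_iota ltn_mod.
  have /implyP/(_ odd_n) odd_B := allP check_odd _ n_in.
  apply: v2_B31; first by apply: contraTneq odd_B => ->.
  by rewrite lognE dvdn2 odd_B !andbF.
- have a32_neq0 : a %% 32 != 0.
    by apply: contraNneq a_neq0 => a0; rewrite -(modn_dvdm (m := 32)) ?a0.
  rewrite (v2_modn32 _ a32_neq0).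
  have /implyP := allP check_4a2 _ (modn32_in _ a32_neq0).
  rewrite [a %% 32 %% 16]modn_dvdm // => /(_ a_neq0)/andP[B_neq0 /eqP logB].
  (* The right-hand side is at most [4 * 31 + 2 = 126], so it is already reduced. *)
  have mod128 : (4 * a + 2) %% 128 = 4 * (a %% 32) + 2.
    rewrite -modnDml -(muln_modr 4 a 32) modn_small //.
    have : a %% 32 <= 31 by rewrite -ltnS ltn_mod.
    by rewrite -(leq_pmul2l (m := 4)) // => le_a;
      rewrite addn2 !ltnS (leq_trans le_a).
  by apply: v2_B31; rewrite mod128.
Qed.
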